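(* Let $A\in\mathbb{R}^{n\times n}$ be nonsingular, and let $W$ and $Z$ be the inverse factors of $A$, i.e. $W$ and $Z^T$ are lower unitriangular matrices such that $$WAZ=D^{-1}$$ for a (nonsingular) diagonal matrix $D=\mathrm{diag}(d_1,\ldots,d_n)$. Put $L:=W^{-1}$ and $U:=Z^{-1}$. Then $A=LD^{-1}U$ is the LDU factorization of $A$, and for all $1\le i<j\le n$, $$L_{ji}=\beta_i^{(j)},\qquad U_{ij}=\alpha_i^{(j)},$$ where $\alpha_i^{(j)}$ and $\beta_i^{(j)}$ are the quantities computed by the FFINV algorithm applied to $A$.
   Context: A lower unitriangular matrix is a lower triangular matrix with unit diagonal. The LDU factorization of $A$ is the factorization of $A$ as (lower unitriangular)$\cdot$(diagonal)$\cdot$(upper unitriangular); here the diagonal factor is $D^{-1}$. FFINV algorithm applied to a matrix $A=(a_{ij})$ of order $n$. Initialize $W=(w_{ij})=I_n$ and $Z=(z_{ij})=I_n$. For $j=1,\ldots,n$ do the following (empty sums are $0$): (1) For $i=j-1,\ldots,1$: $l_i^{(j)}=a_{ji}+\sum_{k=1}^{i-1}a_{jk}z_{ki}$ and $\beta_i^{(j)}=l_i^{(j)}d_i$. (2) For $i=1,\ldots,j-1$: $w_{ji}=-\beta_i^{(j)}-\sum_{k=i+1}^{j-1}\beta_k^{(j)}w_{ki}$. (3) $d_j=1/\bigl(a_{jj}+\sum_{k=1}^{j-1}w_{jk}a_{kj}\bigr)$. (4) For $i=j-1,\ldots,1$: $u_i^{(j)}=a_{ij}+\sum_{k=1}^{i-1}w_{ik}a_{kj}$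 and $\alpha_i^{(j)}=u_i^{(j)}d_i$. (5) For $i=1,\ldots,j-1$: $z_{ij}=-\alpha_i^{(j)}-\sum_{k=i+1}^{j-1}\alpha_k^{(j)}z_{ik}$. The output is $W$, $Z$ and $D=\mathrm{diag}(d_1,\ldots,d_n)$, which are the inverse factors of $A$, satisfying $WAZ=D^{-1}$. *)

(* Defs.v *)
From HB Require Import structures.
From mathcomp Require Import all_boot all_order all_algebra.
From mathcomp Require Import reals.

Set Implicit Arguments.
Unset Strict Implicit.
Unset Printing Implicit Defensive.

Import Order.TTheory GRing.Theory Num.Theory.
Local Open Scope ring_scope.

Definition lower_unitriangular (F : fieldType) (n : nat) (M : 'M[F]_n) : Prop :=
  is_trig_mx M /\ (forall i, M i i = 1).

Definition upper_unitriangular (F : fieldType) (n : nat) (M : 'M[F]_n) : Prop :=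
  lower_unitriangular M^T.

Definition LDU_factors (F : fieldType) (n : nat) (A L D U : 'M[F]_n) : Prop :=
  [/\ lower_unitriangular L, is_diag_mx D, upper_unitriangular U
    & A = L *m D *m U].

(* The second conjunct renders the definite article in "the" factorization. *)
Definition is_the_LDU_factorization (F : fieldType) (n : nat)
    (A L D U : 'M[F]_n) : Prop :=
  LDU_factors A L D U /\
  (forall L' D' U' : 'M[F]_n,
     LDU_factors A L' D' U' -> [/\ L' = L, D' = D & U' = U]).

(* Indices are 0-based.  beta_i^(j) and alpha_i^(j) are stored in row i and
   column j of ffinv_beta and ffinv_alpha, so that the former is indexed by
   the transpose of the position it occupies in the factor L. *)
Record ffinv_state (F : fieldType) (n : nat) := FFINVState {
  ffinv_W : 'M[F]_n;
  ffinv_Z : 'M[F]_n;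
  ffinv_d : 'rV[F]_n;
  ffinv_alpha : 'M[F]_n;
  ffinv_beta : 'M[F]_n
}.

Definition set_entry (F : fieldType) (m n : nat) (M : 'M[F]_(m, n))
    (i0 : 'I_m) (j0 : 'I_n) (x : F) : 'M[F]_(m, n) :=
  \matrix_(i, j) (if (i == i0) && (j == j0) then x else M i j).

(* The increasing list of the indices smaller than j. *)
Definition below (n : nat) (j : 'I_n) : seq 'I_n :=
  [seq i : 'I_n <- enum 'I_n | (i < j)%N].

(* The body of the outer loop.  Each foldl is an inner loop that updates one
   array in place.  The result is None when the denominator of d_j vanishes,
   as the library's inverse is total, with 0^-1 = 0. *)
Definition ffinv_step (F : fieldType) (n : nat) (A : 'M[F]_n)
    (s : ffinv_state F n) (j : 'I_n) : option (ffinv_state F n) :=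
  let: FFINVState W Z d alpha beta := s in
  let beta :=
    foldl (fun b i =>
        let l := A j i + \sum_(k < n | (k < i)%N) A j k * Z k i in
        set_entry b i j (l * d 0 i))
      beta (rev (below j)) in
  let W :=
    foldl (fun w i =>
        set_entry w j i
          (- beta i j - \sum_(k < n | (i < k < j)%N) beta k j * w k i))
      W (below j) in
  let pivot := A j j + \sum_(k < n | (k < j)%N) W j k * A k j in
  if pivot == 0 then None else
  let d := set_entry d 0 j (1 / pivot) in
  let alpha :=
    foldl (fun a i =>
        let u := A i j + \sum_(k < n | (k < i)%N) W i k * A k j in
        set_entry a i j (u * d 0 i))
      alpha (rev (below j)) in
  let Z :=
    foldl (fun z i =>
        set_entry z i j
          (- alpha i j - \sum_(k < n | (i < k < j)%N) alpha k j * z i k))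
      Z (below j) in
  Some (FFINVState W Z d alpha beta).

(* The initial zeros of d, alpha and beta are placeholders: no entry of these
   arrays is read before it has been assigned. *)
Definition ffinv_init (F : fieldType) (n : nat) : ffinv_state F n :=
  FFINVState 1%:M 1%:M 0 0 0.

Definition ffinv (F : fieldType) (n : nat) (A : 'M[F]_n) :
    option (ffinv_state F n) :=
  foldl (fun os j => obind (fun s => ffinv_step A s j) os)
    (Some (ffinv_init F n)) (enum 'I_n).

(* Main.v *)
Require Import Defs.
From HB Require Import structures.
From mathcomp Require Import all_boot all_order all_algebra.
From mathcomp Require Import reals.

Set Implicit Arguments.
Unset Strict Implicit.
Unset Printing Implicit Defensive.

Import Order.TTheory GRing.Theory Num.Theory.
Local Open Scope ring_scope.

(* From W A Z = D^-1 we get L = A Z D and U = D W A, so the sums computed by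
   FFINV in steps (1), (3) and (4) are entries of A Z and W A, hence of L, D^-1
   and U up to a factor d_i; steps (2) and (5) are the off-diagonal entries of
   L W = 1 and Z U = 1 solved for W and Z.  By induction on j, the state before
   step j therefore holds the part of W, Z, D, L and U with indices below j. *)

(** * Entries of products with unitriangular factors *)

(** The unit diagonal contributes [B i j] and the entries of [M] right of the diagonal vanish. This
    is the shape of the sums in steps (3) and (4), read with [M = W] and [B = A]. *)
Lemma mul_lower_unitriangularE (F : fieldType) (n : nat) (M B : 'M[F]_n) i j :
  lower_unitriangular M ->
  (M *m B) i j = B i j + \sum_(k < n | (k < i)%N) M i k * B k j.
Proof.
case=> /is_trig_mxP M0 M1; rewrite mxE (bigD1 i) //= M1 mul1r; congr (_ + _).
rewrite (bigID (fun k : 'I_n => (k < i)%N)) /= addrC big1 ?add0r.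
  by apply: eq_bigl => k; rewrite -val_eqE /=; case: ltngtP.
move=> k /andP[ki]; rewrite -leqNgt leq_eqVlt val_eqE eq_sym (negPf ki) /=.
by move=> /M0 ->; rewrite mul0r.
Qed.

Lemma mul_upper_unitriangularE (F : fieldType) (n : nat) (B M : 'M[F]_n) i j :
  upper_unitriangular M ->
  (B *m M) i j = B i j + \sum_(k < n | (k < j)%N) B i k * M k j.
Proof.
move=> hM; have := mul_lower_unitriangularE B^T j i hM.
rewrite -trmx_mul !mxE => ->; congr (_ + _).
by apply: eq_bigr => k _; rewrite !mxE mulrC.
Qed.

(** Only the [k] from [j] to [i] contribute, and the two ends carry a unit diagonal entry. When the
    product is the identity the right side is 0, which is the recurrence of step (2). *)
Lemma mul_lower_unitriangular2E (F : fieldType) (n : nat) (M N : 'M[F]_n)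
    (i j : 'I_n) :
  lower_unitriangular M -> lower_unitriangular N -> (j < i)%N ->
  (M *m N) i j =
    N i j + M i j + \sum_(k < n | (j < k < i)%N) M i k * N k j.
Proof.
move=> hM [/is_trig_mxP N0 N1] ji.
rewrite mul_lower_unitriangularE // -addrA; congr (_ + _).
rewrite (bigD1 j) //= N1 mulr1; congr (_ + _).
rewrite (bigID (fun k : 'I_n => (j < k)%N)) /= addrC big1 ?add0r.
  by apply: eq_bigl => k; rewrite -val_eqE /=; case: (ltngtP k j); rewrite ?andbF ?andbT.
move=> k /andP[/andP[_ kj]]; rewrite -leqNgt leq_eqVlt val_eqE (negPf kj) /=.
by move=> /N0 ->; rewrite mulr0.
Qed.

Lemma mul_upper_unitriangular2E (F : fieldType) (n : nat) (M N : 'M[F]_n)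
    (i j : 'I_n) :
  upper_unitriangular M -> upper_unitriangular N -> (i < j)%N ->
  (M *m N) i j =
    M i j + N i j + \sum_(k < n | (i < k < j)%N) M i k * N k j.
Proof.
move=> hM hN ij; have := mul_lower_unitriangular2E hN hM ij.
rewrite -trmx_mul !mxE => ->; congr (_ + _).
by apply: eq_bigr => k _; rewrite !mxE mulrC.
Qed.

(** * Products and inverses of unitriangular matrices *)

Lemma lower_unitriangular_mul (F : fieldType) (n : nat) (M N : 'M[F]_n) :
  lower_unitriangular M -> lower_unitriangular N ->
  lower_unitriangular (M *m N).
Proof.
move=> hM [/is_trig_mxP N0 N1]; split=> [|i].
  apply/is_trig_mxP => i j ij; rewrite mul_lower_unitriangularE // N0 // add0r.
  by rewrite big1 // => k ki; rewrite N0 ?mulr0 ?(ltn_trans ki).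
rewrite mul_lower_unitriangularE // N1 big1 ?addr0 // => k ki.
by rewrite N0 ?mulr0.
Qed.

Lemma lower_unitriangular_unitmx (F : fieldType) (n : nat) (M : 'M[F]_n) :
  lower_unitriangular M -> M \in unitmx.
Proof.
by case=> Mtrig M1; rewrite unitmxE det_trig // big1 ?unitr1 // => i _.
Qed.

Lemma lower_unitriangular_invmx (F : fieldType) (n : nat) (M : 'M[F]_n) :
  lower_unitriangular M -> lower_unitriangular (invmx M).
Proof.
move=> hM; have MV := mulmxV (lower_unitriangular_unitmx hM).
have V0 (i j : 'I_n) : (i < j)%N -> invmx M i j = 0.
  (* Strong induction on the row: row [i] of [M *m invmx M = 1] expresses [invmx M i j] through the
     entries above it in column [j]. *)
  have [m] := ubnP (i : nat); elim: m i => // m IH i im ij.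
  have := mul_lower_unitriangularE (invmx M) i j hM.
  rewrite MV mxE -val_eqE ltn_eqF // big1 ?addr0 // => k ki.
  by rewrite IH ?mulr0 //; [apply: leq_trans ki _ | apply: ltn_trans ij].
split=> [|i]; first exact/is_trig_mxP.
have := mul_lower_unitriangularE (invmx M) i i hM.
by rewrite MV mxE eqxx big1 ?addr0 // => k ki; rewrite V0 ?mulr0.
Qed.

Lemma upper_unitriangular_mul (F : fieldType) (n : nat) (M N : 'M[F]_n) :
  upper_unitriangular M -> upper_unitriangular N ->
  upper_unitriangular (M *m N).
Proof.
by move=> hM hN; rewrite /upper_unitriangular trmx_mul;
  apply: lower_unitriangular_mul.
Qed.

Lemma upper_unitriangular_unitmx (F : fieldType) (n : nat) (M : 'M[F]_n) :
  upper_unitriangular M -> M \in unitmx.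
Proof. by move/lower_unitriangular_unitmx; rewrite unitmx_tr. Qed.

Lemma upper_unitriangular_invmx (F : fieldType) (n : nat) (M : 'M[F]_n) :
  upper_unitriangular M -> upper_unitriangular (invmx M).
Proof.
by rewrite /upper_unitriangular trmx_inv; apply: lower_unitriangular_invmx.
Qed.

(** * Diagonal factors and uniqueness of the LDU factorization *)

Lemma diag_mx_unitP (F : fieldType) (n : nat) (d : 'rV[F]_n) :
  reflect (forall i, d 0 i != 0) (diag_mx d \in unitmx).
Proof.
rewrite unitmxE det_diag unitfE.
apply: (iffP (prodf_neq0 _ _)) => h i; first exact: h.
by move=> _; exact: h.
Qed.

Lemma invmx_diag (F : fieldType) (n : nat) (d : 'rV[F]_n) :
  diag_mx d \in unitmx ->
  invmx (diag_mx d) = diag_mx (\row_i (d 0 i)^-1).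
Proof.
move=> ud; apply: (can_inj (mulKmx ud)); rewrite mulmxV // mulmx_diag.
rewrite -diag_const_mx; congr diag_mx; apply/rowP => i.
by rewrite !mxE mulfV //; apply/diag_mx_unitP.
Qed.

(** A matrix that is both lower and upper triangular is diagonal. The unit diagonals give [d' = d],
    and the nonzero entries of [d] can then be cancelled off the diagonal. *)
Lemma lower_diag_eq_diag_upper (F : fieldType) (n : nat) (M N : 'M[F]_n)
    (d d' : 'rV[F]_n) :
  lower_unitriangular M -> upper_unitriangular N -> (forall i, d 0 i != 0) ->
  M *m diag_mx d = diag_mx d' *m N -> [/\ M = 1%:M, d' = d & N = 1%:M].
Proof.
move=> [/is_trig_mxP M0 M1] [/is_trig_mxP N0 N1] d0 /matrixP MN.
have {}MN i j : M i j * d 0 j = d' 0 i * N i j.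
  by have := MN i j; rewrite mul_mx_diag mul_diag_mx !mxE.
have {}N1 i : N i i = 1 by have := N1 i; rewrite mxE.
have {}N0 (i j : 'I_n) : (j < i)%N -> N i j = 0.
  by move=> ji; have := N0 j i ji; rewrite mxE.
have dd' : d' = d.
  by apply/rowP => i; have := MN i i; rewrite M1 N1 mul1r mulr1.
split=> //; apply/matrixP => i j; rewrite mxE -val_eqE; case: ltngtP => ij.
- exact: M0.
- by apply/(mulIf (d0 j)); rewrite MN N0 // mulr0 mul0r.
- by rewrite (val_inj ij) M1.
- by apply/(mulfI (d0 i)); rewrite -{1}dd' -MN M0 // mul0r mulr0.
- exact: N0.
- by rewrite (val_inj ij) N1.
Qed.

(* If L D U = L' D' U', then (L'^-1 L) D = D' (U' U^-1) is both lower and upper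
   triangular. *)
Lemma LDU_factors_unique (F : fieldType) (n : nat) (A L D U L' D' U' : 'M[F]_n) :
  A \in unitmx -> LDU_factors A L D U -> LDU_factors A L' D' U' ->
  [/\ L' = L, D' = D & U' = U].
Proof.
move=> uA [hL /diag_mxP[d ->] hU defA] [hL' /diag_mxP[d' ->] hU' defA'].
have uL' := lower_unitriangular_unitmx hL'.
have uU := upper_unitriangular_unitmx hU.
(* Nonsingularity of [A] passes to its factor [diag_mx d]. *)
have d0 i : d 0 i != 0.
  move: i; apply/diag_mx_unitP; move: uA.
  by rewrite defA !unitmx_mul => /andP[/andP[]].
have [] := @lower_diag_eq_diag_upper _ _ (invmx L' *m L) (U' *m invmx U) d d'.
- exact/lower_unitriangular_mul/hL/lower_unitriangular_invmx.
- exact/upper_unitriangular_mul/upper_unitriangular_invmx.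
- exact: d0.
(* Multiplied by [L'] on the left and [U] on the right, both sides become [A]. *)
- apply: (can_inj (mulKmx uL')); apply: (can_inj (mulmxK uU)).
  by rewrite !mulmxA mulmxV // mul1mx -defA mulmxKV.
move=> LL' -> UU'; split=> //.
  by rewrite -[L](mulKVmx uL') LL' mulmx1.
by rewrite -[U'](mulmxKV uU) UU' mul1mx.
Qed.

(** * Loops that update an array in place *)

(* P is the region the loop may write to; f can rely only on what lies outside,
   where the array already has its final value. *)
Lemma foldl_set_entry (F : fieldType) (m n : nat) (I : eqType)
    (r : I -> 'I_m) (c : I -> 'I_n) (f : 'M[F]_(m, n) -> I -> F)
    (N : 'M[F]_(m, n)) (P : 'I_m -> 'I_n -> bool) (s : seq I) (M : 'M_(m, n)) :
  (forall i, i \in s -> P (r i) (c i)) ->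
  (forall M' : 'M_(m, n), (forall x y, ~~ P x y -> M' x y = N x y) ->
    forall i, i \in s -> f M' i = N (r i) (c i)) ->
  (forall x y, ~~ P x y \/ (x, y) \notin [seq (r i, c i) | i <- s] ->
    M x y = N x y) ->
  foldl (fun M' i => set_entry M' (r i) (c i) (f M' i)) M s = N.
Proof.
elim: s M => [|i s IHs] M hP hf hM.
  by apply/matrixP => x y; apply: hM; right.
apply: IHs => [k ks|M' hM' k ks|x y hxy].
- by apply: hP; rewrite inE ks orbT.
- by apply: hf => //; rewrite inE ks orbT.
(* The entry just written is final, since [f] read an array that agrees with [N] outside [P]; every
   other entry is unchanged. *)
rewrite mxE; case: ifPn => [/andP[/eqP-> /eqP->]|xy].
  by apply: hf => [x' y' Pxy'|]; [apply: hM; left | rewrite mem_head].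
apply: hM; case: hxy => [|xys]; first by left.
by right; rewrite /= inE negb_or xpair_eqE xy.
Qed.

Lemma mem_below (n : nat) (i j : 'I_n) : (i \in below j) = (i < j)%N.
Proof. by rewrite mem_filter mem_enum andbT. Qed.

(** The protected region is all of column [j], so the order of traversal does not matter:
    [s =i below j] covers both the increasing and the decreasing loops. *)
Lemma foldl_set_column (F : fieldType) (n : nat) (j : 'I_n)
    (f : 'M[F]_n -> 'I_n -> F) (N : 'M[F]_n) (s : seq 'I_n) (M : 'M[F]_n) :
  s =i below j ->
  (forall M' : 'M[F]_n, (forall x y, y != j -> M' x y = N x y) ->
    forall i : 'I_n, (i < j)%N -> f M' i = N i j) ->
  (forall x y : 'I_n, ~~ ((x < j)%N && (y == j)) -> M x y = N x y) ->
  foldl (fun M' i => set_entry M' i j (f M' i)) M s = N.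
Proof.
move=> hs hf hM.
apply: (@foldl_set_entry _ _ _ _ id (fun=> j) f N (fun _ y => y == j)) => //.
  by move=> M' hM' i; rewrite hs mem_below; apply: hf.
move=> x y hxy; apply: hM; apply/negP => /andP[xj /eqP yj].
case: hxy => [|/negP[]]; first by rewrite yj eqxx.
by apply/mapP; exists x; rewrite ?hs ?mem_below ?yj.
Qed.

Lemma foldl_set_row (F : fieldType) (n : nat) (j : 'I_n)
    (f : 'M[F]_n -> 'I_n -> F) (N : 'M[F]_n) (s : seq 'I_n) (M : 'M[F]_n) :
  s =i below j ->
  (forall M' : 'M[F]_n, (forall x y, x != j -> M' x y = N x y) ->
    forall i : 'I_n, (i < j)%N -> f M' i = N j i) ->
  (forall x y : 'I_n, ~~ ((x == j) && (y < j)%N) -> M x y = N x y) ->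
  foldl (fun M' i => set_entry M' j i (f M' i)) M s = N.
Proof.
move=> hs hf hM.
apply: (@foldl_set_entry _ _ _ _ (fun=> j) id f N (fun x _ => x == j)) => //.
  by move=> M' hM' i; rewrite hs mem_below; apply: hf.
move=> x y hxy; apply: hM; apply/negP => /andP[/eqP xj yj].
case: hxy => [|/negP[]]; first by rewrite xj eqxx.
by apply/mapP; exists y; rewrite ?hs ?mem_below ?xj.
Qed.

(** * The invariant of the outer loop *)

(** The expected state after [m] steps: finished rows and columns hold final values, the others
    still hold those of [ffinv_init]. The [beta] array holds the transpose of [L]. *)
Definition ffinv_prefix (F : fieldType) (n : nat) (W Z : 'M[F]_n) (d : 'rV[F]_n)
    (m : nat) : ffinv_state F n :=
  FFINVState
    (\matrix_(i, k) if (i < m)%N then W i k else (i == k)%:R)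
    (\matrix_(i, k) if (k < m)%N then Z i k else (i == k)%:R)
    (\row_i if (i < m)%N then d 0 i else 0)
    (\matrix_(i, k) if (i < k < m)%N then invmx Z i k else 0)
    (\matrix_(i, k) if (i < k < m)%N then invmx W k i else 0).

Lemma ffinv_step_prefix (F : fieldType) (n : nat) (A W Z : 'M[F]_n)
    (d : 'rV[F]_n) (j : 'I_n) :
  lower_unitriangular W -> upper_unitriangular Z -> diag_mx d \in unitmx ->
  W *m A *m Z = invmx (diag_mx d) ->
  ffinv_step A (ffinv_prefix W Z d j) j = Some (ffinv_prefix W Z d j.+1).
Proof.
move=> hW hZ ud hWAZ.
have uW := lower_unitriangular_unitmx hW.
have uZ := upper_unitriangular_unitmx hZ.
have hL := lower_unitriangular_invmx hW.
have hU := upper_unitriangular_invmx hZ.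
have LE i k : invmx W i k = (A *m Z) i k * d 0 k.
  have -> : invmx W = A *m Z *m diag_mx d.
    by apply: (can_inj (mulKmx uW)); rewrite !mulmxA hWAZ mulmxV // mulVmx.
  by rewrite mul_mx_diag mxE.
have UE i k : invmx Z i k = d 0 i * (W *m A) i k.
  have -> : invmx Z = diag_mx d *m (W *m A).
    apply: (can_inj (mulmxK uZ)).
    by rewrite -!mulmxA (mulmxA W) hWAZ mulmxV // mulVmx.
  by rewrite mul_diag_mx mxE.
have LW0 (i k : 'I_n) : (i < k)%N ->
    W k i = - invmx W k i - \sum_(l < n | (i < l < k)%N) invmx W k l * W l i.
  move=> ik; apply/eqP; rewrite -subr_eq0 opprD !opprK addrA.
  rewrite -mul_lower_unitriangular2E // mulVmx // mxE -val_eqE.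
  by rewrite gtn_eqF.
have ZU0 (i k : 'I_n) : (i < k)%N ->
    Z i k = - invmx Z i k - \sum_(l < n | (i < l < k)%N) invmx Z l k * Z i l.
  move=> ik; apply/eqP; rewrite -subr_eq0 opprD !opprK addrA.
  under eq_bigr do rewrite mulrC.
  rewrite -mul_upper_unitriangular2E // mulmxV // mxE -val_eqE.
  by rewrite ltn_eqF.
(* The two prefixes differ only at index [j]. *)
have ltS (k : 'I_n) : k != j -> (k < j.+1)%N = (k < j)%N.
  by rewrite ltnS leq_eqVlt val_eqE => /negPf ->.
rewrite /ffinv_step /ffinv_prefix.
(* Suffix 0 marks the arrays before the step, suffix 1 those expected after it. *)
set W0 := \matrix_(_, _) (if _ then W _ _ else _).
set Z0 := \matrix_(_, _) (if _ then Z _ _ else _).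
set d0 := \row__ _.
set alpha0 := \matrix_(_, _) (if _ then invmx Z _ _ else _).
set beta0 := \matrix_(_, _) (if _ then invmx W _ _ else _).
set W1 := \matrix_(i, k) (if (i < j.+1)%N then W i k else _).
set Z1 := \matrix_(i, k) (if (k < j.+1)%N then Z i k else _).
set d1 := \row_i (if (i < j.+1)%N then _ else _).
set alpha1 := \matrix_(_, _) (if (_ < _ < j.+1)%N then invmx Z _ _ else _).
set beta1 := \matrix_(_, _) (if (_ < _ < j.+1)%N then invmx W _ _ else _).
(* Step (1) reads only columns [i < j] of [Z0], where it agrees with [Z], so it computes [A *m Z] at
   row [j], column [i], times [d 0 i]. *)
set beta := foldl _ beta0 _; have {beta}-> : beta = beta1.
  apply: foldl_set_column => [i|_ _ i ij|x y]; first by rewrite mem_rev.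
    rewrite !mxE ij ltnSn /= LE mul_upper_unitriangularE //; congr ((_ + _) * _).
    by apply: eq_bigr => k ki; rewrite mxE ij.
  rewrite !mxE; have [->|yj] := eqVneq y j; last by rewrite ltS.
  by rewrite andbT => /negPf->.
set w := foldl _ W0 _; have {w}-> : w = W1.
  apply: foldl_set_row => // [M hM i ij|x y].
    rewrite !mxE ij ltnSn /= LW0 //; congr (_ - _).
    apply: eq_bigr => k /andP[ik kj]; rewrite !mxE kj ltnSn hM -?val_eqE ?ltn_eqF //.
    by rewrite mxE ltnS ltnW.
  rewrite !mxE; have [->|xj] := eqVneq x j; last by rewrite ltS.
  (* From the diagonal rightwards, row [j] is never written: the initial identity already has the
     values of a lower unitriangular row there. *)
  rewrite ltnn ltnSn -leqNgt leq_eqVlt val_eqE /=.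
  case: eqVneq => [<- _|_ /= jy]; first by case: hW.
  by case: hW => /is_trig_mxP->.
(* The case [i = j] is the pivot of step (3), the cases [i < j] are the sums of step (4). *)
have WA_E (i : 'I_n) : (i <= j)%N ->
    A i j + \sum_(k < n | (k < i)%N) W1 i k * A k j = (W *m A) i j.
  move=> ij; rewrite mul_lower_unitriangularE //; congr (_ + _).
  by apply: eq_bigr => k ki; rewrite mxE ltnS ij.
rewrite WA_E //.
have dj0 : d 0 j != 0 by apply/diag_mx_unitP.
(* The unit diagonal of [U] identifies the pivot as the inverse of [d 0 j]; it is nonzero, so the
   [None] branch is not taken. *)
have dWA : d 0 j * (W *m A) j j = 1.
  by rewrite -UE; case: hU => _ /(_ j); rewrite mxE.
have -> : (W *m A) j j = (d 0 j)^-1 by apply: (mulfI dj0); rewrite dWA mulfV.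
rewrite invr_eq0 (negPf dj0) mul1r invrK.
have -> : set_entry d0 0 j (d 0 j) = d1.
  apply/rowP => i; rewrite !mxE eqxx /=.
  by have [->|ij] := eqVneq i j; rewrite ?ltnSn ?ltS.
set alpha := foldl _ alpha0 _; have {alpha}-> : alpha = alpha1.
  apply: foldl_set_column => [i|_ _ i ij|x y]; first by rewrite mem_rev.
    by rewrite WA_E ?(ltnW ij) // [d1 _ _]mxE [alpha1 _ _]mxE ij ltnSn ltnS ltnW //= UE mulrC.
  rewrite !mxE; have [->|yj] := eqVneq y j; last by rewrite ltS.
  by rewrite andbT => /negPf->.
set z := foldl _ Z0 _; have {z}-> // : z = Z1.
apply: foldl_set_column => // [M hM i ij|x y].
  rewrite !mxE ij ltnSn /= ZU0 //; congr (_ - _).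
  apply: eq_bigr => k /andP[ik kj]; rewrite !mxE kj ltnSn hM -?val_eqE ?ltn_eqF //.
  by rewrite mxE ltnS ltnW.
rewrite !mxE; have [->|yj] := eqVneq y j; last by rewrite ltS.
rewrite ltnn ltnSn andbT -leqNgt leq_eqVlt val_eqE eq_sym /=.
case: hZ => /is_trig_mxP Z0' Z1'.
case: eqVneq => [-> _|_ /= jx]; first by have := Z1' j; rewrite mxE.
by have := Z0' j x jx; rewrite mxE.
Qed.

Lemma ffinv_inverse_factors (F : fieldType) (n : nat) (A W Z : 'M[F]_n)
    (d : 'rV[F]_n) :
  lower_unitriangular W -> upper_unitriangular Z -> diag_mx d \in unitmx ->
  W *m A *m Z = invmx (diag_mx d) ->
  ffinv A = Some (ffinv_prefix W Z d n).
Proof.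
move=> hW hZ ud hWAZ; rewrite /ffinv.
(* Induction needs the state after every initial segment of the index list. *)
suff run m : (m <= n)%N ->
    foldl (fun os j => obind (fun s => ffinv_step A s j) os)
      (Some (ffinv_init F n)) (take m (enum 'I_n)) = Some (ffinv_prefix W Z d m).
  by rewrite -run // take_oversize // size_enum_ord.
elim: m => [_|m IHm mn].
  rewrite take0 /= /ffinv_init /ffinv_prefix; congr (Some (FFINVState _ _ _ _ _)).
  - by apply/matrixP => i k; rewrite !mxE.
  - by apply/matrixP => i k; rewrite !mxE.
  - by apply/matrixP => i k; rewrite !mxE.
  - by apply/matrixP => i k; rewrite !mxE ltn0 andbF.
  - by apply/matrixP => i k; rewrite !mxE ltn0 andbF.
(* [Ordinal mn] is both the default value of [nth] and the element found at position [m]. *)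
rewrite (take_nth (Ordinal mn)) ?size_enum_ord // -cats1 foldl_cat.
rewrite IHm ?(ltnW mn) //= (nth_ord_enum _ (Ordinal mn)).
exact: ffinv_step_prefix.
Qed.

Theorem theorem1 (R : realType) (n : nat) (A W Z : 'M[R]_n) (d : 'rV[R]_n)
    (hA : A \in unitmx)
    (hW : lower_unitriangular W) (hZ : lower_unitriangular Z^T)
    (hd : diag_mx d \in unitmx)
    (hWAZ : W *m A *m Z = invmx (diag_mx d)) :
  let L := invmx W in
  let U := invmx Z in
  is_the_LDU_factorization A L (invmx (diag_mx d)) U /\
  (exists2 s : ffinv_state R n, ffinv A = Some s &
     forall i j : 'I_n, (i < j)%N ->
       L j i = ffinv_beta s i j /\ U i j = ffinv_alpha s i j).
Proof.
move=> L U.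
have LDU : LDU_factors A L (invmx (diag_mx d)) U.
  split; first exact: lower_unitriangular_invmx.
  - by rewrite invmx_diag // diag_mx_is_diag.
  - exact: upper_unitriangular_invmx.
  rewrite -hWAZ !mulmxA mulVmx ?lower_unitriangular_unitmx // mul1mx mulmxK //.
  exact: upper_unitriangular_unitmx.
split; first by split=> // L' D' U'; apply: LDU_factors_unique.
(* At [m = n] the guards of the [alpha] and [beta] arrays reduce to [i < j], leaving the entries of
   [U] and of the transpose of [L]. *)
exists (ffinv_prefix W Z d n); first exact: ffinv_inverse_factors.
by move=> i j ij; rewrite !mxE ij ltn_ord.
Qed.
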